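(* For every $n\ge 1$ and every Boolean function $f:\{0,1\}^n \to \{0,1\}$, \[ \deg_{1/3}(f)^2 \geq \sqrt{\tfrac{6}{101}}\; bs(f). \]
   Context: A real polynomial $p$ on $\mathbb{R}^n$ is an $\varepsilon$-approximation of $f:\{0,1\}^n\to\{0,1\}$ if $|f(x)-p(x)|\le\varepsilon$ for all $x\in\{0,1\}^n$; $\deg_{1/3}(f)$ is the minimum degree of a $\tfrac13$-approximation of $f$. For $x\in\{0,1\}^n$ and $R\subseteq\{1,\dots,n\}$, $x^{(R)}$ is $x$ with the bits indexed by $R$ flipped. The local block sensitivity $bs(f,x)$ is the largest $t$ such that there exist pairwise disjoint $R_1,\dots,R_t\subseteq\{1,\dots,n\}$ with $f(x)\ne f(x^{(R_i)})$ for all $i$; $bs(f)=\max_x bs(f,x)$. *)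

(* Defs.v *)
From HB Require Import structures.
From mathcomp Require Import all_boot all_order all_algebra.
From mathcomp Require Import boolp reals.
From mathcomp Require Import mpoly.

Set Implicit Arguments.
Unset Strict Implicit.
Unset Printing Implicit Defensive.

Import Order.TTheory GRing.Theory Num.Theory.
Local Open Scope ring_scope.

Notation cube n := {ffun 'I_n -> bool}.

Definition embed (R : realType) (n : nat) (x : cube n) : 'I_n -> R :=
  fun i => (x i)%:R.

(* Total degree of a multivariate polynomial (msize p = 1 + degree). *)
Definition mdegree (R : realType) (n : nat) (p : {mpoly R[n]}) : nat :=
  (msize p).-1.

Definition eps_approx (R : realType) (n : nat) (eps : R) (p : {mpoly R[n]})
  (f : cube n -> bool) : Prop :=
  forall x : cube n, `|(f x)%:R - p.@[embed R x]| <= eps.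

Definition interp (R : realType) (n : nat) (f : cube n -> bool) : {mpoly R[n]} :=
  \sum_(y : cube n) (f y)%:R *: \prod_(i < n) (if y i then 'X_i else 1 - 'X_i).

Lemma interp_eval (R : realType) (n : nat) (f : cube n -> bool) (x : cube n) :
  (interp R f).@[embed R x] = (f x)%:R.
Proof.
rewrite /interp raddf_sum /= (bigD1 x) //=.
have -> : \sum_(y | y != x)
     ((f y)%:R *: \prod_(i < n) (if y i then 'X_i else 1 - 'X_i)).@[embed R x]
     = 0 :> R.
  apply: big1 => y yx; rewrite mevalZ rmorph_prod /=.
  have [i yi] : exists i, y i != x i.
    apply/existsP; apply: contraR yx => /existsPn H; apply/eqP/ffunP => i.
    by apply/eqP; move: (H i); rewrite negbK.
  rewrite (bigD1 i) //= mulrCA.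
  move: yi; rewrite /embed; case Eyi: (y i); case Exi: (x i) => //= _.
  - by rewrite mevalXU /= Exi mul0r.
  - by rewrite mevalB meval1 mevalXU /= Exi subrr mul0r.
rewrite addr0 mevalZ rmorph_prod /= big1 ?mulr1 // => i _.
rewrite /embed; case Exi: (x i); rewrite ?mevalB ?meval1 mevalXU /= Exi //.
by rewrite subr0.
Qed.

Lemma approx_exists (R : realType) (n : nat) (f : cube n -> bool) :
  exists d, `[< exists p : {mpoly R[n]},
                 eps_approx (3%:R^-1) p f /\ mdegree p = d >].
Proof.
exists (mdegree (interp R f)); apply/asboolP; exists (interp R f); split=> //.
by move=> x; rewrite interp_eval subrr normr0 invr_ge0 ler0n.
Qed.

Definition approx_deg (R : realType) (n : nat) (f : cube n -> bool) : nat :=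
  ex_minn (approx_exists R f).

Definition flip (n : nat) (x : cube n) (B : {set 'I_n}) : cube n :=
  [ffun i => x i (+) (i \in B)].

(* Local block sensitivity bs(f,x): the largest number of pairwise disjoint
   blocks B with f(x) != f(x^(B)).  Sensitive blocks are nonempty, so pairwise
   disjoint families of sensitive blocks are exactly the sets of blocks P
   with trivIset P (pairwise disjoint) all of whose members are sensitive. *)
Definition bs_at (n : nat) (f : cube n -> bool) (x : cube n) : nat :=
  \max_(P : {set {set 'I_n}} |
          trivIset P && [forall B in P, f (flip x B) != f x]) #|P|.

Definition bs (n : nat) (f : cube n -> bool) : nat :=
  \max_(x : cube n) bs_at f x.

(* Main.v *)
Require Import Defs.
From mathcomp Require Import all_boot all_order all_algebra.
From mathcomp Require Import boolp reals.
From mathcomp Require normed_module derive.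
From mathcomp Require Import trigo.
From mathcomp Require Import ring lra zify.
From mathcomp Require Import mpoly.

Set Implicit Arguments.
Unset Strict Implicit.
Unset Printing Implicit Defensive.

Import Order.TTheory GRing.Theory Num.Theory.
Local Open Scope ring_scope.

(** Let [p] approximate [f] within [eps < 1/2], let [d] be its degree, and put
[cos u = (1 - 2 eps) / (1 + 2 eps)].  Then [bs f <= (tan u / u) d^2], and
[eps = 1/3] gives [cos u = 1/5] and [tan u / u <= 4 < sqrt (101/6)].

Around a point [x], rescale [1 - 2 p] to [s] with [|s| <= 1] on the cube,
[s >= cos u] where [f] agrees with [f x] and [s <= - cos u] elsewhere.  Flipping
each of [N] disjoint sensitive blocks independently with probability [t] makes
the expectation of [s] a polynomial [r] in [t] of degree at most [d], bounded by
[1] on [[0, 1]], with [r 0 >= cos u] and [- r' 0 >= N (r 0 + cos u)].  An affine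
change of the values makes [r 0 = cos u] and [- r' 0 >= 2 N cos u].

Stretch the Chebyshev polynomial [T_d] to [T] with [T 0 = cos u] and all [d]
extrema after the first one in [(0, 1]].  Then [T - r] vanishes at [0] and
alternates weakly at these extrema.  If [T' 0 > r' 0], the quotient
[(T - r) / X], of degree less than [d], alternates at [d + 1] points and is not
zero at [0], which is impossible.  Hence
[- r' 0 <= - T' 0 = d sin u / tan (u / (2 d)) <= 2 d^2 sin u / u]. *)

Section TrigonometricInequalities.
Context {R : realType}.
Implicit Types x : R.
Import normed_module.numFieldNormedType.Exports.

Lemma norm_sin_le x : `|sin x| <= `|x|.
Proof.
wlog x_ge0 : x / 0 <= x => [norm_sin_le_ge0|].
  have [/norm_sin_le_ge0//|/ltW x_le0] := leP 0 x.
  by rewrite -normrN -sinN -[`|x|]normrN norm_sin_le_ge0 ?oppr_ge0.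
have [|c _] := derive.MVT_segment x_ge0 (fun z _ => is_derive_sin z).
  by apply: derive.derivable_within_continuous => z _; exact: derivable_sin.
rewrite sin0 !subr0 => ->.
by rewrite normrM ler_piMl ?normr_ge0 ?cos_max.
Qed.

Lemma cos_ge_1Bsqr x : 1 - x ^+ 2 / 2 <= cos x.
Proof.
have -> : cos x = 1 - 2 * sin (x / 2) ^+ 2.
  by rewrite {1}(splitr x) -mulr2n cos_mulr2n cos2sin2; ring.
have : sin (x / 2) ^+ 2 <= (x / 2) ^+ 2.
  by rewrite -real_normK ?num_real // -[leRHS]real_normK ?num_real //
    lerXn2r ?nnegrE // norm_sin_le.
by rewrite exprMn; set s := sin _ ^+ 2; lra.
Qed.

Lemma tan_ge x : 0 <= x < pi / 2 -> x <= tan x.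
Proof.
move=> /andP[x_ge0 x_lt].
have cos_gt0 z : 0 <= z <= x -> 0 < cos z.
  by move=> /andP[z_ge0 z_le]; apply: cos_gt0_pihalf; apply/andP; split; lra.
have [z z_in||c] := @derive.MVT_segment _ tan (fun z => (cos z) ^- 2) 0 x x_ge0.
- by apply: is_derive_tan; rewrite gt_eqF ?cos_gt0 // !ltW ?(itvP z_in).
- apply: derive.derivable_within_continuous => z z_in.
  by apply: derivable_tan; rewrite gt_eqF ?cos_gt0 // !(itvP z_in).
move=> c_in; rewrite tan0 !subr0 => ->.
have c_gt0 : 0 < cos c by rewrite cos_gt0 // !(itvP c_in).
rewrite -[leLHS]mul1r ler_wpM2r // invf_ge1 ?exprn_gt0 //.
by rewrite exprn_ile1 ?cos_le1 // ltW.
Qed.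

Lemma cosD1_mul_tan_half x : cos (x / 2) != 0 ->
  (1 + cos x) * tan (x / 2) = sin x.
Proof.
move=> c_neq0; rewrite {1 3}(splitr x) -!mulr2n cos_mulr2n sin_mulr2n /tan.
by field.
Qed.

Lemma acos_fifth_ge : 5 / 4 <= acos (5^-1 : R).
Proof.
have pi_ge := @pi_ge2 R; rewrite leNgt; apply/negP => acos_lt.
have fifth_in : -1 <= (5^-1 : R) <= 1 by apply/andP; split; lra.
have : cos (5 / 4 : R) < cos (acos 5^-1).
  rewrite ltr_cos ?in_itv //= ?acos_ge0 ?acos_lepi //.
  by apply/andP; split; lra.
by rewrite acosK ?in_itv //=; have := cos_ge_1Bsqr (5 / 4); lra.
Qed.

Lemma tan_acos_fifth_le : tan (acos (5^-1 : R)) / acos 5^-1 <= 4.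
Proof.
have acos_ge := acos_fifth_ge.
have sin_acos_le1 := sin_le1 (acos (5^-1 : R)).
have fifth_in : -1 <= (5^-1 : R) <= 1 by apply/andP; split; lra.
rewrite ler_pdivrMr; last lra.
by rewrite /tan acosK ?in_itv // invrK; lra.
Qed.

End TrigonometricInequalities.

Section LagrangeInterpolation.
Context {F : fieldType} {m : nat}.
Variable t : 'I_m.+1 -> F.
Implicit Types p : {poly F}.

Definition node_product (i : 'I_m.+1) : F := \prod_(j | j != i) (t i - t j).

Definition node_poly (i : 'I_m.+1) : {poly F} :=
  \prod_(j | j != i) ('X - (t j)%:P).

Lemma size_node_poly i : size (node_poly i) = m.+1.
Proof.
by rewrite /node_poly -big_filter size_prod_XsubC size_filter -sum1_count
  sum1_card cardC1 card_ord.
Qed.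

Lemma coef_node_poly_max i : (node_poly i)`_m = 1.
Proof.
have /eqP := monic_prod_XsubC (index_enum 'I_m.+1) (fun j => j != i) t.
by rewrite lead_coefE -/(node_poly i) size_node_poly.
Qed.

Lemma horner_node_poly i k :
  (node_poly i).[t k] = if i == k then node_product i else 0.
Proof.
rewrite horner_prod; case: eqVneq => [->|ik].
  by apply: eq_bigr => j _; rewrite hornerXsubC.
by rewrite (bigD1 k) 1?eq_sym //= hornerXsubC subrr mul0r.
Qed.

Hypothesis t_inj : injective t.

Lemma node_product_neq0 i : node_product i != 0.
Proof. by apply/prodf_neq0 => j ji; rewrite subr_eq0 (inj_eq t_inj) eq_sym. Qed.

Lemma lagrange_interpolation p : (size p <= m.+1)%N ->
  p = \sum_i (p.[t i] / node_product i) *: node_poly i.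
Proof.
move=> size_p; apply/eqP; rewrite -subr_eq0; apply/eqP.
apply: (@roots_geq_poly_eq0 _ _ (codom t)).
- apply/allP => _ /codomP[k ->]; rewrite rootE !hornerE horner_sum.
  rewrite (bigD1 k) //= big1 => [|i ik]; last first.
    by rewrite hornerZ horner_node_poly (negPf ik) mulr0.
  rewrite hornerZ horner_node_poly eqxx divfK ?node_product_neq0 //.
  by rewrite addr0 subrr.
- by rewrite map_inj_uniq ?enum_uniq.
rewrite size_codom card_ord (leq_trans (size_polyD _ _)) // geq_max size_p.
rewrite size_polyN (leq_trans (size_sum _ _ _)) //; apply/bigmax_leqP => i _.
by rewrite (leq_trans (size_scale_leq _ _)) // size_node_poly.
Qed.

Lemma coef_max_interpolation p : (size p <= m.+1)%N ->
  p`_m = \sum_i p.[t i] / node_product i.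
Proof.
move=> size_p; rewrite {1}(lagrange_interpolation size_p) coef_sum.
by apply: eq_bigr => i _; rewrite coefZ coef_node_poly_max mulr1.
Qed.

End LagrangeInterpolation.

Lemma sum_ltn_ord (n i : nat) : (\sum_(j < n.+1) (i < j) = n - i)%N.
Proof.
elim: n => [|n IHn]; first by rewrite big_ord_recl big_ord0 ltn0.
by rewrite big_ord_recr /= IHn; have [|] := ltnP i n.+1; lia.
Qed.

Section AlternatingPolynomials.
Context {F : realFieldType} {m : nat}.
Variable t : 'I_m.+1 -> F.
Hypothesis t_incr : {homo t : i j / (i < j)%O >-> i < j}.
Implicit Types p : {poly F}.

Let t_inj : injective t := inc_inj (le_mono t_incr).

Lemma node_product_sign (i : 'I_m.+1) : 0 < (-1) ^+ (m - i) * node_product t i.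
Proof.
rewrite /node_product -(sum_ltn_ord m i) (bigD1 i) //= ltnn add0n -prodrXr.
rewrite -big_split /=; apply: prodr_gt0 => j ji.
case: (ltnP i j) => ij; first by rewrite mulN1r oppr_gt0 subr_lt0 t_incr.
by rewrite mul1r subr_gt0 t_incr // ltEord ltn_neqAle ij val_eqE ji.
Qed.

(* The divided difference of [p] at the nodes is zero, and all its terms have
   the same sign. *)
Lemma alternating_eq0 p : (size p <= m)%N ->
  (forall i : 'I_m.+1, 0 <= (-1) ^+ i * p.[t i]) -> forall i, p.[t i] = 0.
Proof.
move=> size_p p_alt.
have term_ge0 (i : 'I_m.+1) : 0 <= (-1) ^+ m * (p.[t i] / node_product t i).
  have -> : (-1) ^+ m = (-1) ^+ i / (-1) ^+ (m - i) :> F.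
    by rewrite invr_sign -exprD subnKC // -ltnS.
  by rewrite mulrACA -invfM divr_ge0 // ltW // node_product_sign.
have sum_eq0 : \sum_i (-1) ^+ m * (p.[t i] / node_product t i) = 0.
  by rewrite -mulr_sumr -coef_max_interpolation ?leqW // nth_default ?mulr0.
move=> i; move/eqP: sum_eq0; rewrite psumr_eq0 => [|j _]; last exact: term_ge0.
move=> /allP/(_ i (mem_index_enum _))/=.
by rewrite !mulf_eq0 invr_eq0 (negPf (node_product_neq0 t_inj i)) signr_eq0 orbF
  => /eqP.
Qed.

Lemma alternating_coef1_le0 p : (size p <= m.+1)%N -> t ord0 = 0 ->
  p.[0] = 0 -> (forall i : 'I_m.+1, 0 <= (-1) ^+ i * p.[t i]) -> p`_1 <= 0.
Proof.
move=> size_p t0 p0 p_alt; rewrite leNgt; apply/negP => p1_gt0.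
have [q pE] : exists q, p = q * 'X.
  have /factor_theorem[q] : root p 0 by apply/rootP.
  by rewrite subr0; exists q.
have q0 : q.[0] = p`_1 by rewrite pE coefMX horner_coef0.
have size_q : (size q <= m)%N.
  have [->|q_neq0] := eqVneq q 0; first by rewrite size_poly0.
  by rewrite -ltnS -size_mulX // -pE.
suff q_alt (i : 'I_m.+1) : 0 <= (-1) ^+ i * q.[t i].
  by have := alternating_eq0 size_q q_alt ord0; rewrite t0 q0; lra.
have [i0|i_gt0] := posnP i.
  by rewrite (_ : i = ord0) ?t0 ?q0 ?mul1r ?ltW //; apply: val_inj.
have ti_gt0 : 0 < t i by rewrite -t0 t_incr.
by rewrite -(pmulr_lge0 _ ti_gt0) -mulrA -hornerMX -pE.
Qed.

End AlternatingPolynomials.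

Lemma two_step_ind (P : nat -> Prop) :
  P 0%N -> P 1%N -> (forall n, P n -> P n.+1 -> P n.+2) -> forall n, P n.
Proof.
move=> P0 P1 PS n; suff: P n /\ P n.+1 by case.
by elim: n => [|n [Pn PSn]]; split=> //; exact: PS.
Qed.

Fixpoint chebyshev (R : nzRingType) (n : nat) : {poly R} :=
  match n with
  | 0 => 1
  | 1 => 'X
  | (m.+1 as k).+1 => 2%:P * 'X * chebyshev R k - chebyshev R m
  end.

Lemma chebyshevSS (R : nzRingType) n :
  chebyshev R n.+2 = 2%:P * 'X * chebyshev R n.+1 - chebyshev R n.
Proof. by []. Qed.

Lemma size_chebyshev (R : nzRingType) n : (size (chebyshev R n) <= n.+1)%N.
Proof.
elim/two_step_ind: n => [||n IHn IHSn]; rewrite ?size_poly1 ?size_polyX //.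
rewrite chebyshevSS (leq_trans (size_polyD _ _)) // geq_max size_polyN.
rewrite (leq_trans IHn (leqW (leqnSn _))) andbT -mulrA mul_polyC.
rewrite (leq_trans (size_scale_leq _ _)) // (leq_trans (size_polyMleq _ _)) //.
by rewrite size_polyX.
Qed.

Lemma horner_chebyshev_cos (R : realType) n (x : R) :
  (chebyshev R n).[cos x] = cos (n%:R * x).
Proof.
elim/two_step_ind: n => [||n IHn IHSn].
- by rewrite hornerC mul0r cos0.
- by rewrite hornerX mul1r.
rewrite chebyshevSS !hornerE IHn IHSn.
have -> : n.+2%:R * x = n.+1%:R * x + x by ring.
have -> : n%:R * x = n.+1%:R * x - x by ring.
by rewrite cosB cosD; ring.
Qed.

Lemma horner_deriv_chebyshev_cos (R : realType) n (x : R) :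
  (chebyshev R n)^`().[cos x] * sin x = n%:R * sin (n%:R * x).
Proof.
elim/two_step_ind: n => [||n IHn IHSn].
- by rewrite derivC hornerC !mul0r.
- by rewrite derivX hornerC !mul1r.
rewrite chebyshevSS !derivE !hornerE mulrBl IHn mulrDl -!mulrA IHSn.
rewrite horner_chebyshev_cos.
have -> : n.+2%:R * x = n.+1%:R * x + x by ring.
have -> : n%:R * x = n.+1%:R * x - x by ring.
by rewrite sinB sinD; ring.
Qed.

Section StretchedChebyshev.
Context {R : realType}.
Variables (d : nat) (u : R).
Local Notation c := (cos (u / d%:R)).

(* The affine map takes [[0, 1]] onto [[-1, c]], and [T_d] takes the value
   [cos u] at [c]. *)
Definition stretched_chebyshev : {poly R} :=
  chebyshev R d \Po (c%:P - (1 + c) *: 'X).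

(* The extremum of [T_d] at angle 0 falls outside [[0, 1]]; the preimage [0] of
   [c] takes its place. *)
Definition alternation_angle (i : nat) : R :=
  (if i is 0 then u else i%:R * pi) / d%:R.

Definition alternation_node (i : nat) : R :=
  (c - cos (alternation_angle i)) / (1 + c).

Lemma size_stretched_chebyshev : (size stretched_chebyshev <= d.+1)%N.
Proof.
have size_affine : (size (c%:P - (1 + c) *: 'X : {poly R})%R <= 2)%N.
  rewrite (leq_trans (size_polyD _ _)) // geq_max size_polyN.
  rewrite (leq_trans (size_polyC_leq1 _)) //=.
  by rewrite (leq_trans (size_scale_leq _ _)) ?size_polyX.
rewrite (leq_trans (size_comp_poly_leq _ _)) // ltnS.
by rewrite -[leqRHS]muln1 leq_mul // -subn1 leq_subLR ?size_chebyshev.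
Qed.

Lemma alternation_node0 : alternation_node 0 = 0.
Proof. by rewrite /alternation_node subrr mul0r. Qed.

Hypotheses (d_gt0 : (0 < d)%N) (u_gt0 : 0 < u) (u_ltpi : u < pi).

Let dR_gt0 : 0 < d%:R :> R. Proof. by rewrite ltr0n. Qed.

Let dK : d%:R * (u / d%:R) = u. Proof. by rewrite mulrC divfK ?gt_eqF. Qed.

Lemma alternation_angle_itv i : (i <= d)%N -> alternation_angle i \in `[0, pi].
Proof.
move=> i_le; have pi0 := @pi_ge0 R; rewrite in_itv /= ler_pdivrMr //.
case: i i_le => [|i] i_le.
  rewrite divr_ge0 ?(ltW u_gt0) //= (le_trans (ltW u_ltpi)) //.
  by rewrite ler_peMr // ler1n.
by rewrite divr_ge0 ?mulr_ge0 //= mulrC ler_wpM2l // ler_nat.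
Qed.

Lemma alternation_angle_incr i j : (i < j)%N ->
  alternation_angle i < alternation_angle j.
Proof.
case: j => // j ij; rewrite ltr_pM2r ?invr_gt0 //.
case: i ij => [|i] ij; last by rewrite ltr_pM2r ?pi_gt0 // ltr_nat.
by rewrite (lt_le_trans u_ltpi) // ler_peMl ?pi_ge0 // ler1n.
Qed.

Let angle0_gt0 : 0 < u / d%:R. Proof. exact: divr_gt0. Qed.

Let angle0_ltpi : u / d%:R < pi.
Proof.
by rewrite ltr_pdivrMr // (lt_le_trans u_ltpi) // ler_peMr ?pi_ge0 // ler1n.
Qed.

Let cosD1_gt0 : 0 < 1 + c.
Proof.
by rewrite -ltrBlDl sub0r -cospi ltr_cos ?in_itv /= ?lexx ?pi_ge0 ?ltW.
Qed.

Lemma alternation_node_incr i j : (i < j <= d)%N ->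
  alternation_node i < alternation_node j.
Proof.
move=> /andP[ij j_le]; rewrite ltr_pM2r ?invr_gt0 // ltrD2l ltrN2.
rewrite ltr_cos ?alternation_angle_incr ?alternation_angle_itv //.
exact: leq_trans (ltnW ij) j_le.
Qed.

Lemma alternation_node_itv i : (i <= d)%N -> 0 <= alternation_node i <= 1.
Proof.
move=> i_le; apply/andP; split.
  case: i i_le => [|i] i_le; first by rewrite alternation_node0.
  by rewrite -[leLHS]alternation_node0 ltW // alternation_node_incr.
by rewrite ler_pdivrMr // mul1r addrC lerD2r lerNl cos_geN1.
Qed.

Lemma horner_stretched_chebyshev_node i :
  stretched_chebyshev.[alternation_node i] =
    if i is 0 then cos u else (-1) ^+ i.
Proof.
have nodeE : (1 + c) * alternation_node i = c - cos (alternation_angle i).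
  by rewrite mulrC divfK ?gt_eqF.
rewrite horner_comp hornerD hornerN hornerC hornerZ hornerX nodeE subKr.
rewrite horner_chebyshev_cos.
rewrite /alternation_angle [d%:R * _]mulrC divfK ?gt_eqF //.
case: i {nodeE} => // i.
by rewrite mulr_natl -[_ *+ _]add0r (alternatingn (@cosDpi R)) cos0 mulr1.
Qed.

Lemma horner0_stretched_chebyshev : stretched_chebyshev.[0] = cos u.
Proof. by rewrite -{1}alternation_node0 horner_stretched_chebyshev_node. Qed.

Lemma coef1_stretched_chebyshev :
  stretched_chebyshev`_1 = - ((1 + c) * (chebyshev R d)^`().[c]).
Proof.
have -> (q : {poly R}) : q`_1 = q^`().[0] by rewrite horner_coef0 coef_deriv.
by rewrite deriv_comp !derivE !hornerE horner_comp !hornerE /= subr0; ring.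
Qed.

Lemma opp_coef1_stretched_chebyshev_le :
  - stretched_chebyshev`_1 <= 2 * d%:R ^+ 2 * (sin u / u).
Proof.
set h := u / d%:R / 2.
have h_gt0 : 0 < h by rewrite divr_gt0.
have h_lt : h < pi / 2 by rewrite ltr_pM2r ?invr_gt0.
have cos_h_neq0 : cos h != 0.
  by rewrite gt_eqF // cos_gt0_pihalf //; apply/andP; split; lra.
have sin_gt0 : 0 < sin (u / d%:R) by rewrite sin_gt0_pi ?angle0_gt0.
set D := (chebyshev R d)^`().[c].
have D_sin : D * sin (u / d%:R) = d%:R * sin u.
  by rewrite horner_deriv_chebyshev_cos dK.
have D_ge0 : 0 <= D.
  by rewrite -(pmulr_lge0 _ sin_gt0) D_sin mulr_ge0 ?sin_ge0_pi ?ltW.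
have : (1 + c) * D * h <= d%:R * sin u.
  rewrite -D_sin -(cosD1_mul_tan_half cos_h_neq0) -/h [leLHS]mulrAC mulrC.
  by rewrite ler_wpM2l // ler_wpM2l ?(ltW cosD1_gt0) // tan_ge // ltW.
rewrite coef1_stretched_chebyshev opprK -/D -ler_pdivlMr // => /le_trans; apply.
suff -> : 2 * d%:R ^+ 2 * (sin u / u) = d%:R * sin u / h by [].
by rewrite /h; field; rewrite !gt_eqF.
Qed.

End StretchedChebyshev.

Lemma bounded_opp_coef1_le (R : realType) (d : nat) (u : R) (r : {poly R}) :
  0 < u < pi -> (size r <= d.+1)%N ->
  (forall t, 0 <= t <= 1 -> `|r.[t]| <= 1) -> r.[0] = cos u ->
  - r`_1 <= 2 * d%:R ^+ 2 * (sin u / u).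
Proof.
move=> /andP[u_gt0 u_ltpi] size_r r_le r0.
have [d0|d_gt0] := posnP d.
  by rewrite d0 in size_r *; rewrite nth_default // expr0n mulr0 mul0r oppr0.
apply: le_trans (opp_coef1_stretched_chebyshev_le d_gt0 u_gt0 u_ltpi).
pose t (i : 'I_d.+1) := alternation_node d u i.
rewrite lerN2 -subr_le0 -coefB; apply: (@alternating_coef1_le0 _ d t).
- move=> i j; rewrite ltEord => ij.
  by apply: alternation_node_incr => //; rewrite ij -ltnS /=.
- rewrite (leq_trans (size_polyD _ _)) // geq_max size_polyN size_r.
  by rewrite size_stretched_chebyshev.
- exact: alternation_node0.
- by rewrite hornerD hornerN r0 horner0_stretched_chebyshev // subrr.
move=> i; have i_le : (i <= d)%N by rewrite -ltnS.
have := alternation_node_itv d_gt0 u_gt0 u_ltpi i_le => /r_le.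
rewrite !hornerE horner_stretched_chebyshev_node // /t.
have [->|i_gt0] := posnP i; first by rewrite alternation_node0 r0 subrr mulr0.
case: (i : nat) i_gt0 => // k _; rewrite ler_norml => /andP[].
by rewrite -signr_odd; case: odd; rewrite ?expr0 ?expr1; lra.
Qed.

Lemma bounded_relative_drop_le (R : realType) (d : nat) (u N : R)
    (r : {poly R}) :
  0 < u < pi / 2 -> (size r <= d.+1)%N ->
  (forall t, 0 <= t <= 1 -> `|r.[t]| <= 1) -> cos u <= r.[0] ->
  0 <= N -> N * (r.[0] + cos u) <= - r`_1 ->
  N <= d%:R ^+ 2 * (tan u / u).
Proof.
move=> /andP[u_gt0 u_lt] size_r r_le r0_ge N_ge0 N_le.
have cos_u_gt0 : 0 < cos u by apply: cos_gt0_pihalf; apply/andP; split; lra.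
(* [s] keeps the lower bound -1 and has [s.[0] = cos u]. *)
pose a := (1 + cos u) / (1 + r.[0]).
have aE : a * (1 + r.[0]) = 1 + cos u by rewrite divfK // gt_eqF //; lra.
have a_gt0 : 0 < a by rewrite divr_gt0 //; lra.
have a_le1 : a <= 1 by rewrite ler_pdivrMr ?mul1r //; lra.
pose s : {poly R} := a *: r + (a - 1)%:P.
have s_le t : 0 <= t <= 1 -> `|s.[t]| <= 1.
  move=> /r_le; rewrite /s hornerD hornerZ hornerC !ler_norml => /andP[? ?].
  by apply/andP; split; nra.
have size_s : (size s <= d.+1)%N.
  rewrite (leq_trans (size_polyD _ _)) // geq_max.
  rewrite (leq_trans (size_scale_leq _ _)) //.
  by rewrite (leq_trans (size_polyC_leq1 _)).
have s0 : s.[0] = cos u by rewrite /s hornerD hornerZ hornerC; lra.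
have u_itv : 0 < u < pi by have := @pi_gt0 R; rewrite u_gt0 /=; lra.
have := bounded_opp_coef1_le u_itv size_s s_le s0.
rewrite /s coefD coefZ coefC addr0 => s1_le.
have sum_ge : 2 * cos u <= a * (r.[0] + cos u).
  by have := cos_le1 u; nra.
have : N * (2 * cos u) <= 2 * d%:R ^+ 2 * (sin u / u).
  apply: le_trans s1_le; apply: le_trans (ler_wpM2l N_ge0 sum_ge) _.
  by rewrite mulrCA -mulrN ler_pM2l.
rewrite mulrCA -mulrA ler_pM2l // => N_cos_le.
by rewrite /tan [_ / u]mulrAC mulrA ler_pdivlMr.
Qed.

Section BernoulliMean.
Context {R : comNzRingType} {K : finType}.
Implicit Types F : {set K} -> R.

(* The expectation of [F Y], where each [k] belongs to [Y] independently with
   probability ['X]. *)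
Definition bernoulli_mean F : {poly R} :=
  \sum_Y F Y *: ('X ^+ #|Y| * (1 - 'X) ^+ #|~: Y|).

Lemma horner_bernoulli_mean F t :
  (bernoulli_mean F).[t] = \sum_Y F Y * (t ^+ #|Y| * (1 - t) ^+ #|~: Y|).
Proof. by rewrite horner_sum; apply: eq_bigr => Y _; rewrite !hornerE. Qed.

Lemma horner0_bernoulli_mean F : (bernoulli_mean F).[0] = F set0.
Proof.
rewrite horner_bernoulli_mean (bigD1 set0) //= cards0 subr0 expr1n !mulr1.
rewrite big1 ?addr0 // => Y; rewrite -cards_eq0 => Y_neq0.
by rewrite expr0n (negPf Y_neq0) mul0r mulr0.
Qed.

Lemma coef1_bernoulli_mean F :
  (bernoulli_mean F)`_1 = \sum_k (F [set k] - F set0).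
Proof.
have coef1_XnX1B m l : ('X ^+ m * (1 - 'X) ^+ l : {poly R})`_1 =
    (m == 1%N)%:R - (m == 0%N)%:R * l%:R.
  rewrite coefXnM; case: m => [|[|m]] //=; last by rewrite mul0r subr0.
    rewrite -[_`_1]mulr1n -coef_deriv -horner_coef0 deriv_exp hornerMn !derivE.
    by rewrite !hornerE subr0 expr1n mulr1 mulNrn.
  by rewrite -horner_coef0 !hornerE /= !subr0 expr1n.
rewrite coef_sum sumrB -big_cards1 sumr_const.
under eq_bigr => Y _ do rewrite coefZ coef1_XnX1B mulrBr.
rewrite sumrB [in RHS]big_mkcond /=; congr (_ - _).
  by apply: eq_bigr => Y _; case: eqP; rewrite ?mulr1 ?mulr0.
rewrite (bigD1 set0) //= cards0 mul1r setC0 cardsT mulr_natr.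
rewrite big1 ?addr0 // => Y; rewrite -cards_eq0 => /negPf->.
by rewrite mul0r mulr0.
Qed.

Lemma bernoulli_mean_sum (I : Type) (s : seq I) (a : I -> R)
    (F : I -> {set K} -> R) :
  bernoulli_mean (fun Y => \sum_(i <- s) a i * F i Y) =
    \sum_(i <- s) a i *: bernoulli_mean (F i).
Proof.
under [RHS]eq_bigr => i _ do rewrite scaler_sumr.
rewrite exchange_big; apply: eq_bigr => Y _.
by rewrite scaler_suml; apply: eq_bigr => i _; rewrite scalerA.
Qed.

Lemma bernoulli_mean_prod (g : K -> bool -> R) :
  bernoulli_mean (fun Y => \prod_k g k (k \in Y)) =
    \prod_k ((g k true)%:P * 'X + (g k false)%:P * (1 - 'X)).
Proof.
rewrite bigA_distr; apply: eq_bigr => Y _ /=.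
rewrite -mul_polyC (rmorph_prod (@polyC R)).
rewrite (bigID (mem Y)) [RHS](bigID (mem Y)) /= mulrACA; congr (_ * _).
  rewrite -prodr_const -big_split; apply: eq_bigr => k /= kY.
  by rewrite kY.
rewrite -prodr_const [X in _ * X](eq_bigl (fun k => k \notin Y)) => [|k].
  by rewrite -big_split; apply: eq_bigr => k /= /negPf ->.
by rewrite inE.
Qed.

Lemma bernoulli_mean_cst a : bernoulli_mean (fun=> a) = a%:P.
Proof.
have sum1 : bernoulli_mean (fun=> 1) = 1.
  have -> : (fun=> 1) = (fun=> \prod_(k : K) 1) :> ({set K} -> R).
    by rewrite big1.
  rewrite (bernoulli_mean_prod (fun=> fun=> 1)); apply: big1 => k _.
  by rewrite !mul1r addrC subrK.
rewrite -[RHS]mulr1 -sum1 mulr_sumr; apply: eq_bigr => Y _.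
by rewrite scale1r mul_polyC.
Qed.

End BernoulliMean.

Section BernoulliMeanOfPolynomial.
Context {R : comNzRingType} {n : nat} {K : finType}.
Variables (p : {mpoly R[n]}) (blk : 'I_n -> K) (v : 'I_n -> bool -> R).

Definition block_monomial (m : 'X_{1..n}) (k : K) (b : bool) : R :=
  \prod_(i | blk i == k) v i b ^+ m i.

Definition block_factor (m : 'X_{1..n}) (k : K) : {poly R} :=
  (block_monomial m k true)%:P * 'X + (block_monomial m k false)%:P * (1 - 'X).

Lemma bernoulli_mean_meval :
  bernoulli_mean (fun Y => p.@[fun i => v i (blk i \in Y)]) =
    \sum_(m <- msupp p) p@_m *: \prod_k block_factor m k.
Proof.
under [RHS]eq_bigr => m _ do rewrite -bernoulli_mean_prod.
rewrite -bernoulli_mean_sum; apply: eq_bigr => Y _; congr (_ *: _).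
rewrite mevalE; apply: eq_bigr => m _; congr (_ * _).
rewrite (partition_big blk predT) //=; apply: eq_bigr => k _.
by apply: eq_bigr => i /eqP ->.
Qed.

Lemma size_block_factor m k :
  (size (block_factor m k) <= (\sum_(i | blk i == k) m i).+1)%N.
Proof.
rewrite /block_factor.
have [deg0|deg_gt0] := posnP (\sum_(i | blk i == k) m i).
  have monomial1 b : block_monomial m k b = 1.
    apply: big1 => i ik; move/eqP: deg0; rewrite sum_nat_eq0 => /forallP/(_ i).
    by rewrite ik => /eqP ->.
  by rewrite !monomial1 !mul1r addrC subrK size_poly1.
set a := block_monomial m k true; set b := block_monomial m k false.
have -> : a%:P * 'X + b%:P * (1 - 'X) = (a - b) *: 'X + b%:P.
  by rewrite -mul_polyC polyCB; ring.
rewrite (leq_trans (size_polyD _ _)) // geq_max.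
rewrite (leq_trans (size_scale_leq _ _)) ?size_polyX //=.
by rewrite (leq_trans (size_polyC_leq1 _)).
Qed.

Lemma size_bernoulli_mean_meval :
  (size (bernoulli_mean (fun Y => p.@[fun i => v i (blk i \in Y)]))
    <= msize p)%N.
Proof.
rewrite bernoulli_mean_meval (leq_trans (size_sum _ _ _)) //.
apply/bigmax_leqP_seq => m m_supp _.
rewrite (leq_trans (size_scale_leq _ _)) //.
apply: leq_trans (msize_mdeg_lt m_supp).
rewrite (leq_trans (size_poly_prod_leq _ _)) // leq_subLR addnS ltnS.
rewrite mdegE (partition_big blk predT) //= -sum1_card -big_split /=.
by apply: leq_sum => k _; rewrite add1n size_block_factor.
Qed.

End BernoulliMeanOfPolynomial.

Lemma norm_bernoulli_mean_le (R : realDomainType) (K : finType)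
    (F : {set K} -> R) (b t : R) :
  (forall Y, `|F Y| <= b) -> 0 <= t <= 1 -> `|(bernoulli_mean F).[t]| <= b.
Proof.
move=> F_le /andP[t_ge0 t_le1].
have -> : b = (bernoulli_mean (fun _ : {set K} => b)).[t].
  by rewrite bernoulli_mean_cst hornerC.
rewrite !horner_bernoulli_mean (le_trans (ler_norm_sum _ _ _)) //.
apply: ler_sum => Y _.
have weight_ge0 : 0 <= t ^+ #|Y| * (1 - t) ^+ #|~: Y|.
  by rewrite mulr_ge0 ?exprn_ge0 ?subr_ge0.
by rewrite normrM [`|_ * _|]ger0_norm // ler_wpM2r.
Qed.

Lemma in_cover_setI (T : finType) (P Y : {set {set T}}) (x : T) : trivIset P ->
  (x \in cover (P :&: Y)) = (x \in cover P) && (pblock P x \in Y).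
Proof.
move=> triv_P; apply/bigcupP/andP => [[B]|[x_cover Y_x]].
  rewrite inE => /andP[PB YB] xB; rewrite (def_pblock triv_P PB xB).
  by split=> //; apply/bigcupP; exists B.
by exists (pblock P x); rewrite ?inE ?Y_x ?pblock_mem ?mem_pblock.
Qed.

Lemma flip0 (n : nat) (x : cube n) : flip x set0 = x.
Proof. by apply/ffunP => i; rewrite ffunE inE addbF. Qed.

Lemma bs_attained (n : nat) (f : cube n -> bool) :
  exists x (P : {set {set 'I_n}}),
    [/\ trivIset P, forall B, B \in P -> f (flip x B) != f x & bs f = #|P|].
Proof.
have cube_gt0 : (0 < #|{: cube n}|)%N by apply/card_gt0P; exists [ffun=> false].
have [x bs_x] := bigop.eq_bigmax (bs_at f) cube_gt0.
pose admissible (P : {set {set 'I_n}}) :=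
  trivIset P && [forall B in P, f (flip x B) != f x].
have adm_gt0 : (0 < #|admissible|)%N.
  apply/card_gt0P; exists set0; rewrite unfold_in /admissible /trivIset /cover.
  by rewrite !big_set0 cards0 eqxx /=; apply/forall_inP => B; rewrite inE.
have [P /andP[triv_P /forall_inP sens] bs_P] :=
  bigop.eq_bigmax_cond (fun P : {set {set 'I_n}} => #|P|) adm_gt0.
by exists x, P; split=> //; rewrite /bs bs_x.
Qed.

Section SignApproximation.
Context {R : realType} {n : nat}.
Variables (eps : R) (f : cube n -> bool) (p : {mpoly R[n]}).

Definition approx_angle : R := acos ((1 - 2 * eps) / (1 + 2 * eps)).

Definition sign_approx (b : bool) : {mpoly R[n]} :=
  ((-1) ^+ b / (1 + 2 * eps)) *: (1 - p *+ 2).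

Lemma msize_sign_approx b : (msize (sign_approx b) <= (mdegree p).+1)%N.
Proof.
rewrite (leq_trans (msizeZ_le _ _)) // (leq_trans (msizeD_le _ _)) // geq_max.
by rewrite msize1 msizeN -scaler_nat (leq_trans (msizeZ_le _ _)) ?leqSpred.
Qed.

Lemma meval_sign_approx b v :
  (sign_approx b).@[v] = (-1) ^+ b * (1 - 2 * p.@[v]) / (1 + 2 * eps).
Proof. by rewrite mevalZ mevalB meval1 mevalMn mulrAC -[_ *+ 2]mulr_natl. Qed.

Hypothesis eps_itv : 0 < eps < 1 / 2.

Let cos_ratio_itv : 0 < (1 - 2 * eps) / (1 + 2 * eps) < 1.
Proof.
have /andP[eps_gt0 eps_lt] := eps_itv.
by rewrite divr_gt0 ?ltr_pdivrMr /=; lra.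
Qed.

Lemma cos_approx_angle : cos approx_angle = (1 - 2 * eps) / (1 + 2 * eps).
Proof.
have /andP[ratio_gt0 ratio_lt1] := cos_ratio_itv.
by rewrite acosK // in_itv /= (ltW ratio_lt1) andbT; lra.
Qed.

Lemma approx_angle_itv : 0 < approx_angle < pi / 2.
Proof.
have /andP[ratio_gt0 ratio_lt1] := cos_ratio_itv.
have ratio_geN1 : -1 <= (1 - 2 * eps) / (1 + 2 * eps) by lra.
have ratio_le1 := ltW ratio_lt1; have pi_ge0 := @pi_ge0 R.
rewrite acos_gt0 ?ratio_geN1 //= ltNge; apply/negP => angle_ge.
have pihalf_in : pi / 2 \in `[(0 : R), pi].
  by rewrite in_itv /=; apply/andP; lra.
have angle_in : approx_angle \in `[(0 : R), pi].
  by rewrite in_itv /= acos_ge0 ?acos_lepi ?ratio_geN1.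
move: angle_ge; rewrite leNgt -(ltr_cos angle_in pihalf_in) cos_pihalf.
by rewrite cos_approx_angle ratio_gt0.
Qed.

Hypothesis approx_p : eps_approx eps p f.

Lemma norm_sign_approx_le b x : `|(sign_approx b).@[embed R x]| <= 1.
Proof.
have /andP[eps_gt0 eps_lt] := eps_itv; have := approx_p x.
have den_gt0 : 0 < 1 + 2 * eps by lra.
rewrite meval_sign_approx !ler_norml ler_pdivlMr // ler_pdivrMr // => /andP[].
case: b; case: (f x) => /=; rewrite ?expr0 ?expr1 => ? ?;
  by apply/andP; split; lra.
Qed.

Lemma sign_approx_ge b x : f x = b ->
  cos approx_angle <= (sign_approx b).@[embed R x].
Proof.
have /andP[eps_gt0 eps_lt] := eps_itv.
have den_gt0 : 0 < 1 + 2 * eps by lra.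
rewrite meval_sign_approx cos_approx_angle ler_pM2r ?invr_gt0 //.
have := approx_p x; rewrite ler_norml => /andP[].
by case: b; case: (f x) => //=; rewrite ?expr0 ?expr1; lra.
Qed.

Lemma sign_approx_le b x : f x != b ->
  (sign_approx b).@[embed R x] <= - cos approx_angle.
Proof.
have /andP[eps_gt0 eps_lt] := eps_itv.
have den_gt0 : 0 < 1 + 2 * eps by lra.
rewrite meval_sign_approx cos_approx_angle -[leRHS]mulNr ler_pM2r ?invr_gt0 //.
have := approx_p x; rewrite ler_norml => /andP[].
by case: b; case: (f x) => //=; rewrite ?expr0 ?expr1; lra.
Qed.

End SignApproximation.

Lemma card_sensitive_blocks_le (R : realType) (n : nat) (eps : R)
    (f : cube n -> bool) (p : {mpoly R[n]}) (x : cube n)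
    (P : {set {set 'I_n}}) :
  0 < eps < 1 / 2 -> eps_approx eps p f -> trivIset P ->
  (forall B, B \in P -> f (flip x B) != f x) ->
  #|P|%:R <= (mdegree p)%:R ^+ 2 * (tan (approx_angle eps) / approx_angle eps).
Proof.
move=> eps_itv approx_p triv_P sens.
pose s := sign_approx eps p (f x).
pose F (Y : {set {set 'I_n}}) := s.@[embed R (flip x (cover (P :&: Y)))].
have F_notin B : B \notin P -> F [set B] = F set0.
  move=> BP; congr (meval (embed R (flip x (cover _))) _).
  by apply/setP => C; rewrite !inE; case: eqP => [->|_] //; rewrite (negPf BP).
have F_in B : B \in P -> F [set B] <= - cos (approx_angle eps).
  move=> BP; rewrite /F (setIidPr _) ?sub1set // cover1.
  by apply: sign_approx_le => //; exact: sens.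
have F0_ge : cos (approx_angle eps) <= F set0.
  by rewrite /F setI0 /cover big_set0 flip0; exact: sign_approx_ge.
apply: (@bounded_relative_drop_le _ _ _ _ (bernoulli_mean F)) => //.
- exact: approx_angle_itv.
- pose v i b : R := (x i (+) ((i \in cover P) && b))%:R.
  have -> : F = fun Y => s.@[fun i => v i (pblock P i \in Y)].
    apply/funext => Y; apply: meval_eq => i.
    by rewrite /embed ffunE in_cover_setI.
  by rewrite (leq_trans (size_bernoulli_mean_meval _ _ _)) // msize_sign_approx.
- move=> t t_in; apply: norm_bernoulli_mean_le t_in => Y.
  exact: norm_sign_approx_le.
- by rewrite horner0_bernoulli_mean.
have -> : (bernoulli_mean F)`_1 = \sum_(B in P) (F [set B] - F set0).
  rewrite coef1_bernoulli_mean (bigID (mem P)) /= [X in _ + X]big1 ?addr0 //.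
  by move=> B /F_notin ->; rewrite subrr.
rewrite horner0_bernoulli_mean -sumrN -sum1_card natr_sum mulr_suml.
by apply: ler_sum => B BP; rewrite mul1r opprB lerD2l lerNr F_in.
Qed.

Lemma bs_le_sqr_mdegree (R : realType) (n : nat) (eps : R)
    (f : cube n -> bool) (p : {mpoly R[n]}) :
  0 < eps < 1 / 2 -> eps_approx eps p f ->
  (bs f)%:R <=
    (mdegree p)%:R ^+ 2 * (tan (approx_angle eps) / approx_angle eps).
Proof.
move=> eps_itv approx_p; have [x [P [triv_P sens ->]]] := bs_attained f.
exact: card_sensitive_blocks_le approx_p triv_P sens.
Qed.

Theorem theorem2 (R : realType) (n : nat) (f : cube n -> bool) :
  (1 <= n)%N ->
  Num.sqrt (6%:R / 101%:R : R) * (bs f)%:R <= ((approx_deg R f) ^ 2)%N%:R.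
Proof.
move=> _; rewrite /approx_deg; case: ex_minnP => _ /asboolP[p [approx_p <-]] _.
have sqrt_le : Num.sqrt (6%:R / 101%:R : R) <= 4^-1.
  rewrite -(@ger0_norm R 4^-1) ?invr_ge0 // -sqrtr_sqr ler_sqrt //; lra.
apply: (le_trans (ler_wpM2r (ler0n _ _) sqrt_le)); rewrite ler_pdivrMl // natrX.
have angleE : approx_angle (3%:R^-1 : R) = acos 5^-1 by congr acos; field.
have third_itv : 0 < (3%:R^-1 : R) < 1 / 2 by apply/andP; split; lra.
apply: le_trans (bs_le_sqr_mdegree third_itv approx_p) _.
by rewrite angleE mulrC ler_wpM2r ?sqr_ge0 // tan_acos_fifth_le.
Qed.
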